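(* There exists a constant $\alpha>0$ such that for every fixed integer $d\ge 3$, every $d$-regular bipartite Ramanujan graph $G$ on $n$ vertices satisfies $$m_G\left(\left[\lambda_2\left(1-\alpha\frac{\log\log n}{\log n}\right),\ \lambda_2\right]\right)=\Omega\left(\frac{n}{\log^{3/2}n}\right)\qquad (n\to\infty),$$ where $\lambda_2$ is the second largest eigenvalue of the adjacency matrix $A_G$ and the implied constant in $\Omega$ (and the threshold for $n$) may depend on $d$.
   Context: For a graph $G$ with adjacency matrix $A_G$ and an interval $I$, $m_G(I)$ here denotes the number of eigenvalues of $A_G$ in $I$, counted with multiplicity. A $d$-regular bipartite Ramanujan graph is a finite connected bipartite $d$-regular graph all of whose adjacency eigenvalues other than $\pm d$ have absolute value at most $2\sqrt{d-1}$. $\log$ is the natural logarithm. *)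

(* Defs.v *)
From HB Require Import structures.
From mathcomp Require Import all_boot all_order all_algebra.
From mathcomp Require Import polyrcf.
From mathcomp Require Import reals exp.

Set Implicit Arguments.
Unset Strict Implicit.
Unset Printing Implicit Defensive.

Import Order.TTheory GRing.Theory Num.Theory.

Local Open Scope ring_scope.

Record sgraph := SGraph {
  vertex :> finType;
  adj : rel vertex;
  adj_sym : symmetric adj;
  adj_irrefl : irreflexive adj }.

Definition connected_graph (G : sgraph) : Prop :=
  (0 < #|G|)%N /\ forall x y : G, connect (@adj G) x y.

Definition bipartite (G : sgraph) : Prop :=
  exists side : G -> bool, forall x y : G, adj x y -> side x != side y.

Definition regular (d : nat) (G : sgraph) : Prop :=
  forall x : G, #|[set y | adj x y]| = d.

Definition adjmx (R : realType) (G : sgraph) : 'M[R]_#|G| :=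
  \matrix_(i, j) (adj (enum_val i) (enum_val j))%:R.

(* All the real eigenvalues of a matrix, each repeated according to its
   multiplicity in the characteristic polynomial, in nonincreasing order.
   For a symmetric matrix (such as [adjmx R G]) all eigenvalues are real, and
   algebraic and geometric multiplicities agree. *)
Definition spectrum (R : realType) (n : nat) (A : 'M[R]_n) : seq R :=
  sort >=%R (flatten [seq nseq (mup x (char_poly A)) x
                     | x <- rootsR (char_poly A)]).

Definition lambda2 (R : realType) (G : sgraph) : R :=
  nth 0 (spectrum (adjmx R G)) 1.

Definition eig_count (R : realType) (G : sgraph) (I : interval R) : nat :=
  count (mem I) (spectrum (adjmx R G)).

Definition bipartite_ramanujan (R : realType) (d : nat) (G : sgraph) : Prop :=
  [/\ connected_graph G, bipartite G, regular d G &
      forall x : R, eigenvalue (adjmx R G) x -> x != d%:R -> x != - d%:R ->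
        `|x| <= 2 * Num.sqrt (d%:R - 1)].

Lemma mem_spectrum (R : realType) (n : nat) (A : 'M[R]_n) (x : R) :
  (x \in spectrum A) = eigenvalue A x.
Proof.
have p0 : char_poly A != 0 by apply: monic_neq0; exact: char_poly_monic.
have rt y : (y \in rootsR (char_poly A)) = root (char_poly A) y.
  by rewrite -(roots_on_rootsR p0).
rewrite eigenvalue_root_char /spectrum mem_sort.
apply/flatten_mapP/idP => [[y yr]|rx].
  by rewrite mem_nseq => /andP[_ /eqP->]; rewrite -rt.
exists x; first by rewrite rt.
by rewrite mem_nseq eqxx andbT -XsubC_dvd // dvdp_XsubCl.
Qed.

Lemma count_mem_spectrum (R : realType) (n : nat) (A : 'M[R]_n) (x : R) :
  count_mem x (spectrum A) = mup x (char_poly A).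
Proof.
have p0 : char_poly A != 0 by apply: monic_neq0; exact: char_poly_monic.
have rt y : (y \in rootsR (char_poly A)) = root (char_poly A) y.
  by rewrite -(roots_on_rootsR p0).
have u : uniq (rootsR (char_poly A)) by exact: uniq_roots.
rewrite /spectrum (permP (permEl (perm_sort _ _))) count_flatten -map_comp.
rewrite sumnE big_map.
under eq_bigr => y _ do rewrite /= count_nseq /=.
have [xr|xr] := boolP (x \in rootsR (char_poly A)).
  rewrite (bigD1_seq x) //= eqxx mul1n big1 ?addn0 // => y /negbTE yx.
  by rewrite yx.
rewrite mupNroot -?rt // big_seq big1 // => y yr.
by case: eqP => // yx; rewrite -yx yr in xr.
Qed.

(* Main.v *)
Require Import Defs.
From mathcomp Require Import all_boot all_order all_algebra.
From mathcomp Require Import sesquilinear spectral complex.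
From mathcomp Require Import reals sequences exp.
From mathcomp Require Import ring lra.
Import Order.TTheory GRing.Theory Num.Theory.
Local Open Scope ring_scope.

(** Apply the trace formula to the test polynomial
    [p = (x + d) (x + rho)^2 v_h(x)^(2N)], where [rho = 2 sqrt (d - 1)] and
    [v_h = cheb (d - 1) h] is the Chebyshev polynomial of the second kind,
    rescaled to the interval between [-rho] and [rho].
    Since [v_r(A)] has natural number entries (it counts non-backtracking walks
    of lengths [r, r - 2, ...]), the trace of [v_h(A)^(2N)] is at least [n] times
    the semicircle integral of [v_h^(2N)]; the latter is estimated from below by
    expanding [v_h^N] in the basis [v_j]: the value and the derivative at [rho]
    give the first two moments of the coefficients.  On the other hand, with
    [delta = log log n / log n], [h] of order [delta^(-1/2)] and [N] of order
    [log log n], the polynomial [p] is smaller than its value at [rho] by a factor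
    [(log n)^2] on [|x| < rho (1 - delta)], because there
    [|v_h| <= (d - 1)^(h / 2) / sqrt delta]; it is small near [-rho], vanishes at
    [-d], and [p(d)] is only [n^o(1)].  Hence the eigenvalues above
    [rho (1 - delta)] must account for a trace of order
    [n p(rho) / (h^2 N)^(3/2)], where [h^2 N] has order [log n].  Finally
    [lambda_2 <= rho], so these eigenvalues, except [d], lie in the window. *)

Set Implicit Arguments.
Unset Strict Implicit.
Unset Printing Implicit Defensive.

(** * Spectral theorem for real symmetric matrices: trace formula and multiplicities *)

Section SymmetricSpectrum.
Variable R : realType.
Local Notation toC := (real_complex R).

(** Over [R[i]] the matrix is Hermitian, so it is unitarily diagonalisable with real eigenvalues.
    The base change [P] stays complex, while the diagonal [r] descends to [R]. *)
Lemma symmetric_diag n (A : 'M[R]_n) : A^T = A ->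
  exists P : 'M[R[i]]_n, exists2 r : 'rV[R]_n, P \in unitmx &
    map_mx toC A = invmx P *m diag_mx (map_mx toC r) *m P.
Proof.
move=> Asym; set B := map_mx toC A.
have Bherm : B \is hermsymmx.
  apply/is_hermitianmxP; rewrite expr0 scale1r; apply/matrixP => i j.
  rewrite !mxE -[in RHS]Asym mxE.
  by apply/eqP; rewrite eq_complex /= oppr0 !eqxx.
have /orthomx_spectralP Beq := hermitian_normalmx Bherm.
have /mxOverP Dreal := hermitian_spectral_diag_real Bherm.
exists (spectralmx B), (map_mx (@complex.Re R) (spectral_diag B)); first exact: spectral_unit.
have -> : map_mx toC (map_mx (@complex.Re R) (spectral_diag B)) = spectral_diag B.
  apply/matrixP => i j; rewrite !mxE.
  have := Dreal i j; case: (spectral_diag B i j) => x y.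
  by rewrite complex_real => /eqP /= ->.
exact: Beq.
Qed.

Lemma char_poly_similar (F : fieldType) n (P D : 'M[F]_n) : P \in unitmx ->
  char_poly (invmx P *m D *m P) = char_poly D.
Proof.
move=> Pu; have PXu : map_mx polyC P \in unitmx.
  by rewrite unitmxE det_map_mx rmorph_unit // -unitmxE.
rewrite /char_poly.
have -> : char_poly_mx (invmx P *m D *m P) =
   invmx (map_mx polyC P) *m char_poly_mx D *m map_mx polyC P.
  rewrite /char_poly_mx mulmxBr mulmxBl scalar_mxC mulmxKV ?unitmx_inv //.
  by rewrite !map_mxM /= map_invmx.
rewrite !det_mulmx mulrAC -det_mulmx mulVmx ?det1 ?mul1r//.
Qed.

Lemma spectrum_char_poly n (A : 'M[R]_n) (s : seq R) :
  char_poly A = \prod_(x <- s) ('X - x%:P) -> perm_eq (spectrum A) s.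
Proof.
move=> cA; apply/allP => x _ /=.
by rewrite count_mem_spectrum cA mu_prod_XsubC.
Qed.

Lemma char_poly_diag (F : fieldType) n (r : 'rV[F]_n) :
  char_poly (diag_mx r) = \prod_i ('X - (r 0 i)%:P).
Proof.
rewrite char_poly_trig ?diag_mx_is_trig//.
by apply: eq_bigr => i _; rewrite mxE eqxx mulr1n.
Qed.

Lemma spectrum_diag n (A : 'M[R]_n) (P : 'M[R[i]]_n) (r : 'rV[R]_n) :
  P \in unitmx -> map_mx toC A = invmx P *m diag_mx (map_mx toC r) *m P ->
  perm_eq (spectrum A) [seq r 0 i | i <- enum 'I_n].
Proof.
move=> Pu eA; apply: spectrum_char_poly; apply: (@map_poly_inj _ _ toC).
rewrite map_char_poly eA char_poly_similar // char_poly_diag big_map big_enum.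
rewrite rmorph_prod /=; apply: eq_bigr => i _.
by rewrite rmorphB /= map_polyX map_polyC /= mxE.
Qed.

Lemma size_spectrum n (A : 'M[R]_n) : A^T = A -> size (spectrum A) = n.
Proof.
move=> /symmetric_diag[P [r Pu eA]].
by rewrite (perm_size (spectrum_diag Pu eA)) size_map size_enum_ord.
Qed.

(** The trace is invariant under the complex base change, and injectivity of [R -> R[i]] brings the
    identity back to [R]. *)
Lemma mxtrace_horner n (A : 'M[R]_n.+1) (p : {poly R}) : A^T = A ->
  \tr (horner_mx A p) = \sum_(x <- spectrum A) p.[x].
Proof.
move=> /symmetric_diag[P [r Pu eA]].
rewrite (perm_big _ (spectrum_diag Pu eA)) big_map big_enum /=.
apply: (@complexI R); rewrite -[LHS]trace_map_mx map_horner_mx eA.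
rewrite horner_mx_uconjC // mxtrace_mulC mulmxA mulmxV // mul1mx.
rewrite horner_mx_diag mxtrace_diag rmorph_sum; apply: eq_bigr => i _.
by rewrite !mxE /= horner_map.
Qed.

Lemma rank_diag_mx (F : fieldType) n (r : 'rV[F]_n) :
  (\rank (diag_mx r) <= #|[pred i | r 0%R i != 0%R]|)%N.
Proof.
have -> : diag_mx r = \sum_(i | r 0 i != 0) r 0 i *: delta_mx i i.
  apply/matrixP => j k; rewrite !mxE summxE.
  under eq_bigr do rewrite !mxE.
  have [->|jk] := eqVneq j k; last first.
    rewrite big1 // => i _; have [ji|] := eqVneq j i; rewrite ?mulr0 //=.
    by rewrite -ji eq_sym (negPf jk) mulr0.
  have [rk0|rk] := eqVneq (r 0 k) 0.
    rewrite rk0 mul0rn big1 // => i ri; have [ki|] := eqVneq k i; rewrite ?mulr0 //.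
    by rewrite -ki rk0 eqxx in ri.
  rewrite (bigD1 k) //= !eqxx mulr1 big1 ?addr0 // => i /andP[_ ik].
  by rewrite eq_sym (negPf ik) mulr0.
rewrite -sum1_card; elim/big_rec2: _ => [|i M k _ IH]; first by rewrite mxrank0.
apply: leq_trans (mxrank_add _ _) (leq_add _ _) => //.
by apply: leq_trans (mxrank_scale _ _) _; rewrite mxrank_delta.
Qed.

(** After diagonalisation, the rank of [A - x] is at most the number of diagonal entries different
    from [x]; the kernel takes up the rest. *)
Lemma count_spectrum n (A : 'M[R]_n) (x : R) : A^T = A ->
  (count_mem x (spectrum A) <= \rank (kermx (A - x%:M)))%N.
Proof.
move=> /symmetric_diag[P [r Pu eA]].
rewrite (permP (spectrum_diag Pu eA)) count_map mxrank_ker.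
have -> : \rank (A - x%:M) = \rank (diag_mx (r - const_mx x)).
  rewrite -2!(mxrank_map toC) map_mxB eA map_scalar_mx map_diag_mx.
  have -> : invmx P *m diag_mx (map_mx toC r) *m P - (toC x)%:M =
     invmx P *m diag_mx (map_mx toC (r - const_mx x)) *m P.
    rewrite map_mxB [diag_mx (_ - _)]linearB.
    rewrite mulmxBr mulmxBl map_const_mx /=.
    by rewrite diag_const_mx scalar_mxC mulmxKV.
  by rewrite mxrankMfree ?row_free_unit // -mxrank_tr trmx_mul mxrankMfree
     ?row_free_unit ?unitmx_tr ?unitmx_inv // mxrank_tr.
rewrite -size_filter leq_subRL; last exact: rank_leq_row.
apply: leq_trans (leq_add (rank_diag_mx _) (leqnn _)) _.
rewrite -[X in (_ <= X)%N]card_ord -(cardC [pred i | r 0 i == x]) addnC.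
apply: leq_add.
  by rewrite cardE enumT.
rewrite (@eq_card _ _ (predC [pred i | r 0 i == x])) // => i.
by rewrite !inE !mxE subr_eq0.
Qed.
End SymmetricSpectrum.

(** * Chebyshev polynomials of the adjacency matrix and non-backtracking walks *)

Fixpoint cheb (R : nzRingType) (q : R) (r : nat) : {poly R} :=
  if r is r'.+1 then
    if r' is r''.+1 then cheb q r' * 'X - q *: cheb q r'' else 'X
  else 1.

Lemma chebSS (R : nzRingType) (q : R) r :
  cheb q r.+2 = cheb q r.+1 * 'X - q *: cheb q r.
Proof. by []. Qed.

(* The number of non-backtracking walks with [r + 1] edges (not [r]) that start at
   [x] and end with the oriented edge [u -> v]. *)
Fixpoint nbwalks (T : finType) (e : rel T) (x : T) (r : nat) (u v : T) : nat :=
  if r is r'.+1 then (e u v * \sum_(t | t != v) nbwalks e x r' t u)%N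
  else e u v && (u == x).

Section NonBacktracking.
Variables (T : finType) (e : rel T) (d : nat).
Hypotheses (e_sym : symmetric e) (e_reg : forall x, (\sum_y e x y = d)%N).
Implicit Types x u v : T.

(** Non-backtracking walks from [x] to [v] with [r + 1] edges; the shift is inherited from
    [nbwalks]. *)
Definition nbends x r v := (\sum_u nbwalks e x r u v)%N.

Lemma nbwalks_edge x r u v : ~~ e u v -> nbwalks e x r u v = 0%N.
Proof. by case: r => [|r] /= /negPf ->. Qed.

Lemma nbends0 x v : nbends x 0 v = e x v.
Proof.
rewrite /nbends /= (bigD1 x) //= eqxx andbT big1 ?addn0 // => u /negPf ->.
by rewrite andbF.
Qed.

(** A walk ending at [u] can be prolonged by the edge [u -> v] unless its last edge was [v -> u];
    the two terms on the left separate these cases. *)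
Lemma nbwalksS x r u v :
  (nbwalks e x r.+1 u v + nbwalks e x r v u = e u v * nbends x r u)%N.
Proof.
have [uv|uv] := boolP (e u v); last first.
  by rewrite !nbwalks_edge // 1?e_sym // mul0n.
by rewrite /= uv !mul1n /nbends [in RHS](bigD1 v) //= addnC.
Qed.

Lemma sum_nbwalks0 x v : (\sum_u nbwalks e x 0 v u = d * (v == x))%N.
Proof.
rewrite -(e_reg v) big_distrl; apply: eq_bigr => u _ /=.
by rewrite mulnb.
Qed.

Lemma sum_nbwalksS x r v :
  (\sum_u nbwalks e x r.+1 v u + nbends x r v = d * nbends x r v)%N.
Proof.
rewrite {1}/nbends -big_split -(e_reg v) big_distrl; apply: eq_bigr => u _ /=.
exact: nbwalksS.
Qed.

Lemma nbendsS x r v :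
  (nbends x r.+1 v + \sum_u nbwalks e x r v u = \sum_u nbends x r u * e u v)%N.
Proof.
rewrite {1}/nbends -big_split; apply: eq_bigr => u _.
by rewrite [RHS]mulnC -nbwalksS.
Qed.

End NonBacktracking.

Section GraphMatrix.
Variables (R : realType) (n d : nat) (e : rel 'I_n.+1).
Hypotheses (e_sym : symmetric e) (e_reg : forall x, (\sum_y e x y = d)%N).
Let A : 'M[R]_n.+1 := \matrix_(i, j) (e i j)%:R.
Let q : R := d%:R - 1.
Let W r : 'M[R]_n.+1 := \matrix_(i, j) (nbends e i r j)%:R.
Local Notation V r := (horner_mx A (cheb q r)).

Lemma nbends_mx0 : W 0%N = A.
Proof. by apply/matrixP => i j; rewrite !mxE nbends0. Qed.

Lemma nbends_mx1 : W 1%N = A * A - d%:R%:M.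
Proof.
apply/matrixP => i j; rewrite !mxE.
have := nbendsS e_sym i 0 j; rewrite (sum_nbwalks0 e_reg) => /(congr1 (fun k => k%:R : R)).
rewrite natrD natr_sum => /(canRL (addrK _)) ->.
rewrite natrM mulr_natr [j == i]eq_sym; congr (_ - _).
by apply: eq_bigr => k _; rewrite nbends0 !mxE natrM.
Qed.

(** Multiplication by [A] prolongs each walk by one edge. The prolongations that backtrack return to
    the end of a shorter walk, and each shorter walk is reached through its [d - 1] admissible
    continuations, whence the coefficient [q]. *)
Lemma nbends_mxSS r : W r.+2 = W r.+1 * A - q *: W r.
Proof.
apply/matrixP => i j; rewrite !mxE.
have := nbendsS e_sym i r.+1 j => /(congr1 (fun k => k%:R : R)).
have := sum_nbwalksS e_sym e_reg i r j => /(congr1 (fun k => k%:R : R)).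
rewrite !natrD natrM => /(canRL (addrK _)) ->.
rewrite natr_sum => /(canRL (addrK _)) ->; rewrite /q mulrBl mul1r.
by congr (_ - _); apply: eq_bigr => k _; rewrite !mxE natrM.
Qed.

Lemma cheb_mxSS r : V r.+2 = V r.+1 * A - q *: V r.
Proof. by rewrite chebSS rmorphB rmorphM /= horner_mx_X linearZ. Qed.

(** Both sides obey the same two-term recurrence, so the induction carries two consecutive indices.
    At the start, [A * A - d] and [A * A - q] differ by the identity, which is [V 0]. *)
Lemma cheb_mx_nbends r : V r.+2 = W r.+1 + V r.
Proof.
suff: V r.+2 = W r.+1 + V r /\ V r.+3 = W r.+2 + V r.+1 by case.
have V0 : V 0%N = 1 by rewrite rmorph1.
have V1 : V 1%N = A by rewrite horner_mx_X.
elim: r => [|r [IH1 IH2]].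
  have V2 : V 2%N = W 1%N + V 0%N.
    rewrite (cheb_mxSS 0) nbends_mx1 V1 V0 -[d%:R](subrK 1) -/q raddfD /= opprD.
    by rewrite -addrA addrNK -scalemx1.
  split=> //; rewrite cheb_mxSS V2 nbends_mxSS nbends_mx0 V0 V1 mulrDl mul1r.
  by rewrite addrAC.
split=> //; rewrite cheb_mxSS IH2 IH1 [W r.+3]nbends_mxSS mulrDl scalerDr.
by rewrite -IH1 cheb_mxSS opprD addrACA.
Qed.

Lemma cheb_mx_nat r i j : V r i j \is a Num.nat.
Proof.
elim/ltn_ind: r => -[|[|r]] IH.
- by rewrite rmorph1 mxE; apply: natr_nat.
- by rewrite horner_mx_X mxE; apply: natr_nat.
by rewrite cheb_mx_nbends mxE rpredD ?IH // mxE natr_nat.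
Qed.

Lemma adj_sym_mx : A^T = A.
Proof. by apply/matrixP => i j; rewrite !mxE e_sym. Qed.

Lemma horner_mx_sym p : (horner_mx A p)^T = horner_mx A p.
Proof.
elim/poly_ind: p => [|p c IH]; first by rewrite rmorph0 trmx0.
rewrite rmorphD rmorphM /= horner_mx_X horner_mx_C raddfD /= tr_scalar_mx.
congr (_ + _); rewrite [LHS]trmx_mul IH adj_sym_mx.
by apply: comm_mx_horner.
Qed.

(** By regularity the all-ones vector is an eigenvector of [A] for [d]. *)
Lemma sum_horner_mx p i : \sum_j horner_mx A p i j = p.[d%:R].
Proof.
elim/poly_ind: p i => [|p c IH] i.
  by rewrite rmorph0 horner0 big1 // => j _; rewrite mxE.
rewrite rmorphD rmorphM /= horner_mx_X horner_mx_C hornerMXaddC.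
under eq_bigr do rewrite !mxE.
rewrite big_split /= exchange_big /=; congr (_ + _).
  under eq_bigr do rewrite -mulr_sumr.
  rewrite -(IH i) mulr_suml; apply: eq_bigr => k _; congr (_ * _).
  by under eq_bigr do rewrite mxE; rewrite -natr_sum e_reg.
by rewrite (bigD1 i) //= eqxx big1 ?addr0 // => j; rewrite eq_sym => /negPf ->.
Qed.

(** By symmetry the trace is the sum of the squared entries; these entries are natural numbers, so
    each square is at least the entry, and every row sums to the value at [d]. *)
Lemma mxtrace_cheb_sqr r : n.+1%:R * (cheb q r).[d%:R] <= \tr (V r * V r).
Proof.
have -> : n.+1%:R * (cheb q r).[d%:R] = \sum_i \sum_j V r i j.
  under eq_bigr do rewrite sum_horner_mx.
  by rewrite sumr_const card_ord mulr_natl.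
apply: ler_sum => i _; rewrite mxE; apply: ler_sum => j _.
rewrite -[in X in _ * X](horner_mx_sym) mxE.
have /natrP[k ->] := cheb_mx_nat r i j; rewrite -natrM ler_nat.
by case: k => // k; rewrite leq_pmulr.
Qed.

End GraphMatrix.

(** * Chebyshev polynomials: products, nonnegative expansions, values and bounds *)

Lemma cheb_mulSS (R : comNzRingType) (q : R) h j :
  cheb q h.+1 * cheb q j.+1 = cheb q (h + j).+2 + q *: (cheb q h * cheb q j).
Proof.
suff: cheb q h.+1 * cheb q j.+1 = cheb q (h + j).+2 + q *: (cheb q h * cheb q j)
  /\ cheb q h.+2 * cheb q j.+1 = cheb q (h + j).+3 + q *: (cheb q h.+1 * cheb q j).
  by case.
elim: h => [|h [IH1 IH2]].
  split; rewrite /= -!mul_polyC ?add0n; case: j => [|j] /=; rewrite -?mul_polyC; ring.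
split=> //; rewrite chebSS mulrBl mulrAC IH2 -scalerAl IH1 !addSn [cheb q _.+4]chebSS.
rewrite [cheb q h.+2]chebSS -!mul_polyC; ring.
Qed.

(** A quadratic form in two consecutive terms which the recurrence multiplies by [q] at each
    step. *)
Lemma cheb_quadratic (R : comNzRingType) (q x : R) r :
  q * (cheb q r).[x] ^+ 2 - x * (cheb q r).[x] * (cheb q r.+1).[x]
    + (cheb q r.+1).[x] ^+ 2 = q ^+ r.+1.
Proof.
elim: r => [|r IH]; first by rewrite hornerC hornerX; ring.
rewrite [q ^+ _.+2]exprS -IH chebSS hornerD hornerN hornerMX hornerZ; ring.
Qed.

Section ChebCone.
Variables (R : numDomainType) (q : R).
Hypothesis q_ge0 : 0 <= q.

Definition cheb_cone (p : {poly R}) := exists m (a : nat -> R),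
  (forall j, 0 <= a j) /\ p = \sum_(j < m) a j *: cheb q j.

Lemma cheb_cone0 : cheb_cone 0.
Proof. by exists 0%N, (fun=> 0); split=> //; rewrite big_ord0. Qed.

Lemma cheb_cone_cheb j : cheb_cone (cheb q j).
Proof.
exists j.+1, (fun i => (i == j)%:R); split=> [i|]; first exact: ler0n.
rewrite big_ord_recr /= eqxx scale1r big1 ?add0r // => i _.
by rewrite ltn_eqF // scale0r.
Qed.

Lemma cheb_coneD p1 p2 : cheb_cone p1 -> cheb_cone p2 -> cheb_cone (p1 + p2).
Proof.
move=> [m1 [a1 [a1_ge0 ->]]] [m2 [a2 [a2_ge0 ->]]].
exists (maxn m1 m2),
  (fun i => (if (i < m1)%N then a1 i else 0) + (if (i < m2)%N then a2 i else 0)).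
split=> [j|]; first by apply: addr_ge0; case: ifP.
apply: esym; under eq_bigr do rewrite scalerDl.
rewrite big_split /=; congr (_ + _).
  rewrite (big_ord_widen _ (fun i => a1 i *: cheb q i) (leq_maxl m1 m2)) [RHS]big_mkcond.
  by apply: eq_bigr => i _; case: ifP; rewrite ?scale0r.
rewrite (big_ord_widen _ (fun i => a2 i *: cheb q i) (leq_maxr m1 m2)) [RHS]big_mkcond.
by apply: eq_bigr => i _; case: ifP; rewrite ?scale0r.
Qed.

Lemma cheb_coneZ c p : 0 <= c -> cheb_cone p -> cheb_cone (c *: p).
Proof.
move=> c0 [m [a [a_ge0 ->]]]; exists m, (fun i => c * a i).
split=> [j|]; first exact: mulr_ge0.
by rewrite scaler_sumr; apply: eq_bigr => i _; rewrite scalerA.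
Qed.

Lemma cheb_cone_mul h j : cheb_cone (cheb q h * cheb q j).
Proof.
elim: h j => [|h IH] [|j]; rewrite ?mul1r ?mulr1; try exact: cheb_cone_cheb.
rewrite cheb_mulSS; apply: cheb_coneD; first exact: cheb_cone_cheb.
exact: cheb_coneZ.
Qed.

Lemma cheb_cone_exp h N : cheb_cone (cheb q h ^+ N).
Proof.
elim: N => [|N [m [a [a_ge0 IH]]]]; first by rewrite expr0; apply: (cheb_cone_cheb 0).
rewrite exprS IH mulr_sumr; apply: (big_ind cheb_cone cheb_cone0 cheb_coneD) => j _.
by rewrite -scalerAr; apply/cheb_coneZ/cheb_cone_mul.
Qed.

End ChebCone.

Section ChebValues.
Variables (R : rcfType) (s : R).
Hypothesis s_gt0 : 0 < s.
Local Notation q := (s ^+ 2).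
Local Notation rho := (2 * s).

(** At [rho] the characteristic equation of the recurrence has the double root [s]. *)
Lemma cheb_edge r : (cheb q r).[rho] = s ^+ r * r.+1%:R.
Proof.
suff: (cheb q r).[rho] = s ^+ r * r.+1%:R /\
  (cheb q r.+1).[rho] = s ^+ r.+1 * r.+2%:R by case.
elim: r => [|r [IH1 IH2]]; first by rewrite hornerC hornerX; split; ring.
by split=> //; rewrite chebSS hornerD hornerN hornerMX hornerZ IH1 IH2 !exprS; ring.
Qed.

(** The factor [3 * rho] clears the denominators of the classical value [r (r + 1) (r + 2) / 3] of
    the derivative of the second-kind polynomial at 1. *)
Lemma cheb_deriv_edge r :
  3 * rho * (cheb q r)^`().[rho] = s ^+ r * (r * r.+1 * r.+2)%:R.
Proof.
suff: 3 * rho * (cheb q r)^`().[rho] = s ^+ r * (r * r.+1 * r.+2)%:R /\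
  3 * rho * (cheb q r.+1)^`().[rho] = s ^+ r.+1 * (r.+1 * r.+2 * r.+3)%:R by case.
elim: r => [|r [IH1 IH2]].
  by rewrite derivC derivX !hornerC; split; ring.
split=> //; rewrite chebSS derivB derivM derivX derivZ mulr1.
rewrite hornerD hornerN hornerD hornerMX hornerZ cheb_edge.
transitivity (rho * (3 * rho * (cheb q r.+1)^`().[rho]) +
  3 * rho * (s ^+ r.+1 * r.+2%:R) - q * (3 * rho * (cheb q r)^`().[rho])).
  by ring.
by rewrite IH1 IH2 !exprS; ring.
Qed.

(** For [x = rho cos u] this says that the sine of [(r + 1) u] is at most 1 in absolute value;
    algebraically, a square is completed in [cheb_quadratic]. *)
Lemma cheb_sqr_le x r :
  (1 - (x / rho) ^+ 2) * (cheb q r).[x] ^+ 2 <= q ^+ r.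
Proof.
have q_gt0 : 0 < q by apply: exprn_gt0.
rewrite -(ler_pM2l q_gt0) -exprS -(cheb_quadratic q x r) -subr_ge0.
set v := (cheb q r).[x]; set w := (cheb q r.+1).[x].
have -> : q * v ^+ 2 - x * v * w + w ^+ 2 - q * ((1 - (x / rho) ^+ 2) * v ^+ 2)
  = (w - x * v / 2) ^+ 2.
  by field; rewrite lt0r_neq0.
exact: sqr_ge0.
Qed.

Lemma cheb_le x r : `|x| <= rho -> `|(cheb q r).[x]| <= s ^+ r * r.+1%:R.
Proof.
move=> x_le; elim: r => [|r IH]; first by rewrite hornerC normr1 mulr1.
have q_gt0 : 0 < q by apply: exprn_gt0.
set v := (cheb q r).[x] in IH *; set w := (cheb q r.+1).[x].
have -> : w = x / 2 * v + (w - x / 2 * v) by ring.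
have x2 : x ^+ 2 <= rho ^+ 2.
  by rewrite -(real_normK (num_real x)) lerXn2r ?nnegrE ?mulr_ge0 // ltW.
(* With [x = rho cos u], the difference is [s ^+ r.+1] times the cosine of [(r + 1) u]. *)
have wv : `|w - x / 2 * v| <= s ^+ r.+1.
  rewrite -(@ler_pXn2r _ 2) ?nnegrE ?exprn_ge0 ?(ltW s_gt0) //.
  rewrite real_normK ?num_real // -exprM mulnC exprM -(cheb_quadratic q x r).
  rewrite -/v -/w -subr_ge0.
  have -> : q * v ^+ 2 - x * v * w + w ^+ 2 - (w - x / 2 * v) ^+ 2
    = (rho ^+ 2 - x ^+ 2) / 4 * v ^+ 2 by field.
  by rewrite mulr_ge0 ?sqr_ge0 // divr_ge0 // subr_ge0.
apply: le_trans (ler_normD _ _) _.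
have -> : s ^+ r.+1 * r.+2%:R = s * (s ^+ r * r.+1%:R) + s ^+ r.+1.
  by rewrite exprS; ring.
apply: lerD wv; rewrite normrM ler_pM //.
by rewrite normrM normfV (ger0_norm (ler0n _ 2)) ler_pdivrMr // mulrC.
Qed.
End ChebValues.

(** At [q + 1] the value is the geometric sum of the powers of [q] up to [q ^+ r]. *)
Lemma cheb_degree (R : numDomainType) (q : R) r : 0 <= q ->
  q ^+ r <= (cheb q r).[q + 1] <= (q + 1) ^+ r.
Proof.
move=> q0.
have rec k : (cheb q k.+1).[q + 1] = q * (cheb q k).[q + 1] + 1.
  elim: k => [|k IH]; first by rewrite hornerC hornerX mulr1.
  by rewrite chebSS hornerD hornerN hornerMX hornerZ IH; ring.
elim: r => [|r /andP[IH1 IH2]]; first by rewrite hornerC !expr0 lexx.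
rewrite rec !exprS mulrDl mul1r; apply/andP; split.
  by apply: le_trans (ler_wpM2l q0 IH1) _; rewrite lerDl.
apply: lerD; first exact: ler_wpM2l.
by apply: exprn_ege1; rewrite lerDr.
Qed.

(** * A lower bound for a sum of squares from two moments *)

Section Moment.
Variable R : realFieldType.

Lemma sum_sqr_trunc m J :
  \sum_(j < m) (if (j < J)%N then j.+1%:R ^+ 2 else 0) <= J%:R ^+ 3 :> R.
Proof.
apply: (@le_trans _ _ ((minn m J)%:R * J%:R ^+ 2)); last first.
  by rewrite [leRHS]exprS ler_wpM2r ?exprn_ge0 // ler_nat geq_minr.
elim: m => [|m IH]; first by rewrite big_ord0 min0n mul0r.
rewrite big_ord_recr /=; case: ifP => mJ; last first.
  rewrite addr0; apply: le_trans IH _; rewrite ler_wpM2r ?exprn_ge0 // ler_nat.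
  by rewrite leq_min geq_minr andbT (leq_trans (geq_minl _ _)).
rewrite (minn_idPl mJ) -[in leRHS]natr1 mulrDl mul1r; apply: lerD.
  by move: IH; rewrite (minn_idPl (ltnW mJ)).
by apply: lerXn2r; rewrite ?nnegrE ?ler_nat ?ler0n.
Qed.

(* Markov's inequality keeps half of the mass of the weights [b j * (j+1)] on
   [j < J], where Cauchy-Schwarz applies; [t] is the optimal multiplier. *)
Lemma moment_sum_sqr m (b : nat -> R) (F Q : R) J :
  (forall j, 0 <= b j) -> 0 <= F -> (0 < J)%N -> 2 * Q <= J%:R ^+ 2 ->
  \sum_(j < m) b j * j.+1%:R = F ->
  \sum_(j < m) b j * j.+1%:R ^+ 3 <= F * Q ->
  F ^+ 2 / (4 * J%:R ^+ 3) <= \sum_(j < m) b j ^+ 2.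
Proof.
move=> b_ge0 F_ge0 J_gt0 QJ sumF sumQ.
have J0 : 0 < J%:R :> R by rewrite ltr0n.
have [t tE] : exists t, t = F / (2 * J%:R ^+ 3) by eexists.
have t_ge0 : 0 <= t by rewrite tE divr_ge0 // mulr_ge0 // exprn_ge0 // ltW.
(* A pointwise form of Cauchy-Schwarz: for [j < J] it follows from the square of
   [b j - t * (j + 1)], and for [J <= j] the left side is nonpositive. *)
have key j : 2 * t * (b j * j.+1%:R) - 2 * t / J%:R ^+ 2 * (b j * j.+1%:R ^+ 3)
    - t ^+ 2 * (if (j < J)%N then j.+1%:R ^+ 2 else 0) <= b j ^+ 2.
  have : (J <= j)%N -> J%:R ^+ 2 <= j.+1%:R ^+ 2 :> R.
    by move=> Jj; apply: lerXn2r; rewrite ?nnegrE ?ler0n ?ler_nat ?leqW.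
  move: (j.+1%:R : R) (ler0n R j.+1) => k k_ge0 Jk.
  have tb : 0 <= 2 * t * b j by rewrite !mulr_ge0.
  case: ltnP => jJ.
    apply: (@le_trans _ _ (2 * t * (b j * k) - t ^+ 2 * k ^+ 2)).
      by rewrite lerB // gerBl !mulr_ge0 ?exprn_ge0 ?invr_ge0 ?exprn_ge0 ?(ltW J0).
    rewrite -subr_ge0.
    have -> : b j ^+ 2 - (2 * t * (b j * k) - t ^+ 2 * k ^+ 2) = (b j - t * k) ^+ 2.
      by ring.
    exact: sqr_ge0.
  have {}Jk := Jk jJ.
  rewrite mulr0 subr0; apply: le_trans (sqr_ge0 _).
  have -> : 2 * t * (b j * k) - 2 * t / J%:R ^+ 2 * (b j * k ^+ 3)
    = (2 * t * b j) * (k * (J%:R ^+ 2 - k ^+ 2) / J%:R ^+ 2).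
    by field; rewrite lt0r_neq0.
  rewrite mulr_ge0_le0 // pmulr_lle0 ?invr_gt0 ?exprn_gt0 //.
  by rewrite mulr_ge0_le0 // subr_le0.
apply: le_trans (ler_sum _ (fun (j : 'I_m) _ => key j)).
rewrite !sumrB -!mulr_sumr sumF.
apply: (@le_trans _ _ (2 * t * F - 2 * t / J%:R ^+ 2 * (F * Q) - t ^+ 2 * J%:R ^+ 3)).
  have -> : 2 * t * F - 2 * t / J%:R ^+ 2 * (F * Q) - t ^+ 2 * J%:R ^+ 3 =
    F ^+ 2 / (4 * J%:R ^+ 3) + (t * F / J%:R ^+ 2) * (J%:R ^+ 2 - 2 * Q).
    by rewrite tE; field; rewrite lt0r_neq0.
  rewrite lerDl mulr_ge0 ?subr_ge0 // divr_ge0 ?mulr_ge0 ?exprn_ge0 //.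
apply: lerB; last by rewrite ler_wpM2l ?sqr_ge0 ?sum_sqr_trunc.
by rewrite lerB // ler_wpM2l // divr_ge0 ?mulr_ge0 ?exprn_ge0.
Qed.
End Moment.

(** * Lower bound for the trace of the test polynomial *)

Section Trace.
Variables (R : realType) (n d : nat) (e : rel 'I_n.+1).
Hypotheses (e_sym : symmetric e) (e_reg : forall x, (\sum_y e x y = d)%N).
Hypothesis d_gt1 : (1 < d)%N.
Let A : 'M[R]_n.+1 := \matrix_(i, j) (e i j)%:R.
Let q : R := d%:R - 1.
Let s : R := Num.sqrt q.

Let q_gt0 : 0 < q.
Proof. by rewrite subr_gt0 ltr1n. Qed.
Let s_gt0 : 0 < s.
Proof. by rewrite sqrtr_gt0. Qed.
Let sqr_s : s ^+ 2 = q.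
Proof. by rewrite sqr_sqrtr // ltW. Qed.

Definition nonneg_mx m (M : 'M[R]_m) := forall i j, 0 <= M i j.

Lemma nonneg_mulmx m (M N : 'M[R]_m) : nonneg_mx M -> nonneg_mx N -> nonneg_mx (M *m N).
Proof. by move=> M0 N0 i j; rewrite mxE sumr_ge0 // => k _; rewrite mulr_ge0. Qed.

Lemma nonneg_mxtrace m (M : 'M[R]_m) : nonneg_mx M -> 0 <= \tr M.
Proof. by move=> M0; apply: sumr_ge0. Qed.

Lemma nonneg_cheb_mx r : nonneg_mx (horner_mx A (cheb q r)).
Proof. by move=> i j; apply/natr_ge0/cheb_mx_nat. Qed.

Lemma nonneg_exp_mx (M : 'M[R]_n.+1) N : nonneg_mx M -> nonneg_mx (M ^+ N).
Proof.
move=> M0; elim: N => [|N IH]; last by rewrite exprS; apply: nonneg_mulmx.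
by move=> i j; rewrite expr0 mxE ler0n.
Qed.

(** The dropped term is the trace of a product of entrywise nonnegative matrices. Nonnegativity is
    part of the conclusion so that the bound can be iterated over the linear factors. *)
Lemma mxtrace_shift_ge (c : R) (p : {poly R}) : 0 <= c ->
  nonneg_mx (horner_mx A p) ->
  nonneg_mx (horner_mx A (('X + c%:P) * p)) /\
  c * \tr (horner_mx A p) <= \tr (horner_mx A (('X + c%:P) * p)).
Proof.
move=> c0 p0; rewrite rmorphM rmorphD /= horner_mx_X horner_mx_C mulrDl.
have Ap : nonneg_mx (A * horner_mx A p).
  by apply: nonneg_mulmx => // i j; rewrite mxE.
have -> : c%:M * horner_mx A p = c *: horner_mx A p by rewrite -mul_scalar_mx.
split=> [i j|]; first by rewrite !mxE addr_ge0 ?mulr_ge0 //; have := Ap i j; rewrite mxE.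
by rewrite mxtraceD mxtraceZ lerDr nonneg_mxtrace.
Qed.

Lemma mxtrace_cheb_exp h N J : (0 < N)%N -> (0 < J)%N ->
  2 * (N%:R * h.+1%:R ^+ 2) <= J%:R ^+ 2 :> R ->
  n.+1%:R * (((s ^+ h * h.+1%:R) ^+ N) ^+ 2 / (4 * J%:R ^+ 3))
    <= \tr (horner_mx A (cheb q h ^+ N * cheb q h ^+ N)).
Proof.
move=> N_gt0 J_gt0 hJ.
have [m [a [a_ge0 expand]]] := cheb_cone_exp (ltW q_gt0) h N.
pose b j := a j * s ^+ j.
pose F := (s ^+ h * h.+1%:R) ^+ N.
have F_ge0 : 0 <= F by rewrite exprn_ge0 // mulr_ge0 ?exprn_ge0 // ltW.
have edge j : (cheb q j).[2 * s] = s ^+ j * j.+1%:R.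
  by have := cheb_edge s j; rewrite sqr_s.
have deriv_edge j : 3 * (2 * s) * (cheb q j)^`().[2 * s] = s ^+ j * (j * j.+1 * j.+2)%:R.
  by have := cheb_deriv_edge s j; rewrite sqr_s.
have sumF : \sum_(j < m) b j * j.+1%:R = F.
  rewrite /F -edge -horner_exp expand horner_sum; apply: eq_bigr => j _.
  by rewrite hornerZ edge mulrA.
have sum3 : \sum_(j < m) b j * (j * j.+1 * j.+2)%:R = F * (N%:R * (h * h.+2)%:R).
  have -> : \sum_(j < m) b j * (j * j.+1 * j.+2)%:R =
      3 * (2 * s) * (cheb q h ^+ N)^`().[2 * s].
    rewrite expand raddf_sum horner_sum mulr_sumr; apply: eq_bigr => j _ /=.
    by rewrite derivZ hornerZ mulrCA deriv_edge mulrA.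
  rewrite deriv_exp hornerMn hornerM horner_exp -[_ *+ N]mulr_natr !mulrA.
  rewrite -[3 * 2 * s]mulrA deriv_edge edge /F.
  by rewrite -[in RHS](prednK N_gt0) [in RHS]exprS prednK //; ring.
(* The cube of [j + 1] is [j + 1] plus [j (j + 1) (j + 2)], so it mixes the value and the derivative
   at the edge; the remaining single [F] is absorbed since [N] is at least 1. *)
have sumQ : \sum_(j < m) b j * j.+1%:R ^+ 3 <= F * (N%:R * h.+1%:R ^+ 2).
  have -> : \sum_(j < m) b j * j.+1%:R ^+ 3 = F + F * (N%:R * (h * h.+2)%:R).
    by rewrite -sum3 -sumF -big_split; apply: eq_bigr => j _ /=; ring.
  rewrite -{1}[F]mulr1 -mulrDr ler_wpM2l //.
  have N1 : 1 <= N%:R :> R by rewrite ler1n.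
  have -> : h.+1%:R ^+ 2 = 1 + (h * h.+2)%:R :> R by ring.
  by rewrite mulrDr mulr1 lerD2r.
have b_ge0 j : 0 <= b j by rewrite mulr_ge0 // exprn_ge0 // ltW.
apply: le_trans (ler_wpM2l (ler0n _ _) (moment_sum_sqr b_ge0 F_ge0 J_gt0 hJ sumF sumQ)) _.
rewrite expand rmorphM /= raddf_sum /= mulr_sumr.
set M : 'M_n.+1 := \sum_(i < m) _.
have -> : M * M = \sum_(i < m) \sum_(j < m) (a i * a j) *:
    (horner_mx A (cheb q i) * horner_mx A (cheb q j)).
  rewrite {1}/M mulr_suml; apply: eq_bigr => i _; rewrite mulr_sumr; apply: eq_bigr => j _.
  by rewrite !linearZ -scalerAl -scalerAr scalerA.
(* Only the diagonal terms of the double sum are kept: each is at least [n.+1] times [b i ^+ 2],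
   while the others are nonnegative. *)
rewrite raddf_sum; apply: ler_sum => i _; rewrite raddf_sum (bigD1 i) //=.
rewrite -[leLHS]addr0; apply: lerD.
  rewrite mxtraceZ /b exprMn -exprM mulnC exprM sqr_s mulrCA -expr2.
  apply: ler_wpM2l; first exact: sqr_ge0.
  apply: le_trans (mxtrace_cheb_sqr R e_sym e_reg i); rewrite ler_wpM2l ?ler0n //.
  by have /andP[] := cheb_degree i (ltW q_gt0); rewrite subrK.
apply: sumr_ge0 => j _; rewrite mxtraceZ !mulr_ge0 //.
by apply/nonneg_mxtrace/nonneg_mulmx; apply: nonneg_cheb_mx.
Qed.

Lemma mxtrace_test_ge h N J (c1 c2 : R) : (0 < N)%N -> (0 < J)%N -> 0 <= c1 -> 0 <= c2 ->
  2 * (N%:R * h.+1%:R ^+ 2) <= J%:R ^+ 2 :> R ->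
  c1 * c2 ^+ 2 * (n.+1%:R * (((s ^+ h * h.+1%:R) ^+ N) ^+ 2 / (4 * J%:R ^+ 3)))
    <= \tr (horner_mx A (('X + c1%:P) * (('X + c2%:P) * (('X + c2%:P) *
         (cheb q h ^+ N * cheb q h ^+ N))))).
Proof.
move=> N_gt0 J_gt0 c1_ge0 c2_ge0 hJ.
have := mxtrace_cheb_exp N_gt0 J_gt0 hJ.
set f := cheb q h ^+ N * cheb q h ^+ N => trf.
have f_ge0 : nonneg_mx (horner_mx A f).
  rewrite rmorphM /= rmorphXn; apply: nonneg_mulmx; apply: nonneg_exp_mx;
  exact: nonneg_cheb_mx.
have [f1 tr1] := mxtrace_shift_ge c2_ge0 f_ge0.
have [f2 tr2] := mxtrace_shift_ge c2_ge0 f1.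
have [_ tr3] := mxtrace_shift_ge c1_ge0 f2.
apply: le_trans tr3; rewrite -mulrA ler_wpM2l //; apply: le_trans tr2.
by rewrite expr2 -mulrA ler_wpM2l //; apply: le_trans tr1; rewrite ler_wpM2l.
Qed.
End Trace.

(** * Maximum principle and simplicity of the eigenvalue [d] *)

Lemma harmonic_const (R : realFieldType) (T : finType) (e : rel T) (d : nat) (f : T -> R) :
  symmetric e -> (forall x, (\sum_y e x y = d)%N) -> (forall x y, connect e x y) ->
  (forall x, \sum_y (e x y)%:R * f y = d%:R * f x) -> forall x y, f x = f y.
Proof.
move=> e_sym e_reg e_conn harm x0.
pose m := [arg max_(x > x0) f x]%O.
have fm x : f x <= f m by rewrite /m; case: arg_maxP => // i _ /(_ x isT).
(* Where [f] attains its maximum, the nonnegative differences [f m - f z] over the neighbours [z]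
   sum to zero. *)
have step x y : e x y -> f x = f m -> f y = f m.
  move=> xy fx; have /psumr_eq0P sum0 : \sum_z (e x z)%:R * (f m - f z) = 0.
    under eq_bigr do rewrite mulrBr.
    by rewrite sumrB harm fx -mulr_suml -natr_sum e_reg subrr.
  have /eqP : (e x y)%:R * (f m - f y) = 0.
    by apply: sum0 => // z _; rewrite mulr_ge0 ?ler0n ?subr_ge0.
  by rewrite xy mul1r subr_eq0 => /eqP.
have pathE z p : path e z p -> f z = f m -> f (last z p) = f m.
  by elim: p z => //= a p IH z /andP[za pa] fz; apply: IH pa (step _ _ za fz).
have fE x : f x = f m by have /connectP[p /pathE + ->] := e_conn m x; apply.
by move=> y; rewrite !fE.
Qed.

Section Spectrum.
Variables (R : realType) (n d : nat) (e : rel 'I_n).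
Hypotheses (e_sym : symmetric e) (e_reg : forall x, (\sum_y e x y = d)%N).
Hypothesis e_conn : forall x y, connect e x y.
Let A : 'M[R]_n := \matrix_(i, j) (e i j)%:R.

(** An eigenvector for [d] is harmonic, hence constant by connectedness, so the kernel has dimension
    at most one. *)
Lemma count_top_eigenvalue : (count_mem d%:R (spectrum A) <= 1)%N.
Proof.
have Asym : A^T = A by apply/matrixP => i j; rewrite !mxE e_sym.
apply: leq_trans (count_spectrum _ Asym) _.
apply: leq_trans (rank_leq_row (const_mx 1 : 'rV[R]_n)).
apply/mxrankS/row_subP => i; set v := row i _.
have /sub_kermxP : (v <= kermx (A - d%:R%:M))%MS by exact: row_sub.
rewrite mulmxBr => /eqP; rewrite subr_eq0 mul_mx_scalar => /eqP vA.
have v_const : forall x y, v 0 x = v 0 y.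
  apply: (@harmonic_const _ _ e d (v 0)) => // x.
  have := congr1 (fun w : 'rV[R]_n => w 0 x) vA; rewrite !mxE => <-.
  by apply: eq_bigr => j _; rewrite [A j x]mxE e_sym mulrC.
have -> : v = v 0 i *: const_mx 1.
  by apply/rowP => j; rewrite [RHS]mxE [const_mx 1 _ _]mxE mulr1; apply: v_const.
exact: scalemx_sub.
Qed.
End Spectrum.

(** * Upper bound for the test polynomial and eigenvalue count near the edge *)

Lemma test_poly_le (R : rcfType) (s x v d delta eps : R) (h N : nat) :
  0 < s -> 2 * s <= d -> `|x| <= 2 * s -> 0 < delta -> delta <= 1 -> 0 <= eps ->
  (delta ^+ N)^-1 <= eps * (h.+1%:R ^+ N) ^+ 2 ->
  v = (cheb (s ^+ 2) h).[x] ->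
  (x + d) * ((x + 2 * s) * ((x + 2 * s) * (v ^+ N * v ^+ N))) <=
  d * (2 * s) ^+ 2 * ((s ^+ h * h.+1%:R) ^+ N) ^+ 2 *
    (8 * (2 * s * (1 - delta) <= x)%R%:R + (2 * delta ^+ 2 + 8 * eps)).
Proof.
move=> s_gt0 sd x_le delta_gt0 delta_le1 eps_ge0 epsP vE.
have := cheb_sqr_le s_gt0 x h; have := cheb_le s_gt0 h x_le; rewrite -vE.
set G := s ^+ h * h.+1%:R => v_le v_sqr.
have rho_gt0 : 0 < 2 * s by rewrite mulr_gt0.
have G_ge0 : 0 <= G by rewrite mulr_ge0 ?exprn_ge0 // ltW.
have vG : v ^+ N * v ^+ N <= (G ^+ N) ^+ 2.
  rewrite -expr2 -!exprM ![(N * _)%N]mulnC !exprM.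
  by apply: lerXn2r; rewrite ?nnegrE ?sqr_ge0 // -[v ^+ 2]real_normK ?num_real //
    lerXn2r ?nnegrE.
have y_ge0 : 0 <= v ^+ N * v ^+ N by rewrite -expr2 sqr_ge0.
have [y yE] : exists y, y = v ^+ N * v ^+ N by eexists.
rewrite -yE in vG y_ge0 *; rename vG into yG.
set Y := (G ^+ N) ^+ 2 in yG *.
have Y_ge0 : 0 <= Y by apply: sqr_ge0.
move: x_le; rewrite ler_norml => /andP[x_ge x_le].
have d_ge0 : 0 <= d by apply: le_trans sd; apply: ltW.
have bound (u w : R) : 0 <= u -> x + 2 * s <= u -> y <= w * Y -> 0 <= w ->
    (x + d) * ((x + 2 * s) * ((x + 2 * s) * y)) <= 2 * d * (u * (u * (w * Y))).
  move=> u_ge0 xu yw w_ge0.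
  have x0 : 0 <= x + 2 * s by lra.
  have xd0 : 0 <= x + d by lra.
  have xd : x + d <= 2 * d by lra.
  have wY : 0 <= w * Y by apply: mulr_ge0.
  by rewrite !ler_pM ?mulr_ge0.
have c1_ge0 : 0 <= d * (2 * s) ^+ 2 * Y by rewrite !mulr_ge0 ?exprn_ge0 // ltW.
(* Near the right edge the trivial bounds [x + d <= 2 * d] and [x + 2 * s <= 4 * s] give the
   constant 8. *)
case: (lerP (2 * s * (1 - delta)) x) => xt.
  apply: (le_trans (bound (2 * (2 * s)) 1 _ _ _ _)); rewrite ?mul1r //; try lra.
  rewrite mulr1 mulrDr.
  have -> : 2 * d * (2 * (2 * s) * (2 * (2 * s) * Y)) = d * (2 * s) ^+ 2 * Y * 8 by ring.
  rewrite lerDl mulr_ge0 // addr_ge0 // mulr_ge0 ?sqr_ge0 //.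
rewrite mulr0 add0r.
(* Near the left edge the double factor [x + 2 * s] supplies [delta ^+ 2]. *)
have [xt2|xt2] := lerP x (- (2 * s * (1 - delta))).
  apply: (le_trans (bound (2 * s * delta) 1 _ _ _ _)); rewrite ?mul1r //; try lra.
  rewrite mulrDr.
  have -> : 2 * d * (2 * s * delta * (2 * s * delta * Y))
    = d * (2 * s) ^+ 2 * Y * (2 * delta ^+ 2) by ring.
  by rewrite lerDl mulr_ge0 // mulr_ge0.
apply: (le_trans (bound (2 * (2 * s)) eps _ _ _ _)) => //; try lra; last first.
  rewrite mulrDr.
  have -> : 2 * d * (2 * (2 * s) * (2 * (2 * s) * (eps * Y)))
    = d * (2 * s) ^+ 2 * Y * (8 * eps) by ring.
  by rewrite lerDr mulr_ge0 // mulr_ge0 ?sqr_ge0.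
(* In the middle range, [1 - (1 - delta) ^+ 2] is at least [delta], so [cheb_sqr_le] bounds [v]. *)
have small : delta * v ^+ 2 <= (s ^+ 2) ^+ h.
  apply: le_trans v_sqr; rewrite ler_wpM2r ?sqr_ge0 //.
  have z1 : `|x / (2 * s)| <= 1 - delta.
    rewrite normrM normfV (gtr0_norm rho_gt0) ler_pdivrMr // ler_norml; apply/andP; split.
      by rewrite mulrC ltW.
    by rewrite mulrC ltW.
  have : `|x / (2 * s)| ^+ 2 <= (1 - delta) ^+ 2.
    by apply: lerXn2r; rewrite ?nnegrE // subr_ge0.
  rewrite real_normK ?num_real // => z2.
  have : delta ^+ 2 <= delta by rewrite expr2 ger_pMr.
  by lra.
have deltaN : 0 < delta ^+ N by apply: exprn_gt0.
have -> : Y = ((s ^+ 2) ^+ h) ^+ N * (h.+1%:R ^+ N) ^+ 2.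
  by rewrite /Y /G 2![in LHS]exprMn exprAC [s ^+ h ^+ 2]exprAC.
apply: (@le_trans _ _ ((delta ^+ N)^-1 * ((s ^+ 2) ^+ h) ^+ N)); last first.
  by rewrite mulrCA mulrC ler_wpM2l // !exprn_ge0 // ltW.
rewrite ler_pdivlMl // yE -expr2 -exprM mulnC exprM -exprMn.
apply: lerXn2r; rewrite ?nnegrE ?exprn_ge0 ?(ltW s_gt0) //.
by rewrite mulr_ge0 ?sqr_ge0 ?ltW.
Qed.

Lemma natr_count (R : pzSemiRingType) (T : Type) (P : pred T) (r : seq T) :
  \sum_(x <- r) (P x)%:R = (count P r)%:R :> R.
Proof. by rewrite -natr_sum -sum1_count [in RHS]big_mkcond. Qed.

(** Passes from sizes [n.+1], where matrices form a ring, to any positive size, so that [#|G|] can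
    be used. *)
Lemma spectrum_test_ge (R : realType) (n d : nat) (e : rel 'I_n) h N J (c1 c2 : R) :
  symmetric e -> (forall x, (\sum_y e x y = d)%N) -> (1 < d)%N -> (0 < n)%N ->
  (0 < N)%N -> (0 < J)%N -> 0 <= c1 -> 0 <= c2 ->
  2 * (N%:R * h.+1%:R ^+ 2) <= J%:R ^+ 2 :> R ->
  c1 * c2 ^+ 2 * (n%:R *
    (((Num.sqrt (d%:R - 1) ^+ h * h.+1%:R) ^+ N) ^+ 2 / (4 * J%:R ^+ 3))) <=
  \sum_(x <- spectrum (\matrix_(i, j) (e i j)%:R : 'M[R]_n))
    (('X + c1%:P) * (('X + c2%:P) * (('X + c2%:P) *
      (cheb (d%:R - 1) h ^+ N * cheb (d%:R - 1) h ^+ N)))).[x].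
Proof.
case: n e => // n e e_sym e_reg d_gt1 _ N_gt0 J_gt0 c1_ge0 c2_ge0 hJ.
rewrite -mxtrace_horner; last by apply/matrixP => i j; rewrite !mxE e_sym.
exact: mxtrace_test_ge.
Qed.

Lemma two_sqrt_pred_le (R : realType) (d : nat) : (1 < d)%N ->
  2 * Num.sqrt (d%:R - 1) <= d%:R :> R.
Proof.
move=> d_gt1; have := sqr_ge0 (Num.sqrt (d%:R - 1) - 1 : R).
by rewrite sqrrB sqr_sqrtr ?subr_ge0 ?ler1n 1?ltnW //; lra.
Qed.

Section Counting.
Variables (R : realType) (n d : nat) (e : rel 'I_n).
Hypotheses (e_sym : symmetric e) (e_reg : forall x, (\sum_y e x y = d)%N).
Hypothesis e_conn : forall x y, connect e x y.
Hypothesis d_gt1 : (1 < d)%N.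
Let A : 'M[R]_n := \matrix_(i, j) (e i j)%:R.
Let s : R := Num.sqrt (d%:R - 1).
Hypothesis ramanujan : forall x : R, eigenvalue A x ->
  x != d%:R -> x != - d%:R -> `|x| <= 2 * s.

Let s_ge1 : 1 <= s.
Proof.
have d2 : 2 <= d%:R :> R by rewrite ler_nat.
by rewrite -sqrtr1 /s ler_sqrt; lra.
Qed.
Let sqr_s : s ^+ 2 = d%:R - 1.
Proof. by rewrite sqr_sqrtr // subr_ge0 ler1n ltnW. Qed.
Let rho_le : 2 * s <= d%:R.
Proof. exact: two_sqrt_pred_le. Qed.

Lemma spectrum_ramanujan x : x \in spectrum A ->
  [\/ x = d%:R, x = - d%:R | `|x| <= 2 * s].
Proof.
rewrite mem_spectrum => Ax; have [->|xd] := eqVneq x d%:R; first exact: Or31.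
have [->|xNd] := eqVneq x (- d%:R); first exact: Or32.
by apply: Or33; apply: ramanujan.
Qed.

(** Both bounds on the sum of [p] over the spectrum are compared and divided by [C]. The eigenvalue
    [-d] is a root of [p], and [d], being simple, costs at most one extra [p.[d]]. *)
Lemma count_near_edge (delta eps : R) h N J : (0 < n)%N -> (0 < N)%N -> (0 < J)%N ->
  0 < delta -> delta <= 1 -> 0 <= eps ->
  (delta ^+ N)^-1 <= eps * (h.+1%:R ^+ N) ^+ 2 ->
  2 * (N%:R * h.+1%:R ^+ 2) <= J%:R ^+ 2 :> R ->
  n%:R / (4 * J%:R ^+ 3) <=
    8 * (count (fun x => 2 * s * (1 - delta) <= x) (spectrum A))%:R
    + n%:R * (2 * delta ^+ 2 + 8 * eps) + 8 * d%:R ^+ (2 * h * N + 2).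
Proof.
move=> n_gt0 N_gt0 J_gt0 delta_gt0 delta_le1 eps_ge0 epsP hJ.
pose G : R := s ^+ h * h.+1%:R.
pose C := d%:R * (2 * s) ^+ 2 * (G ^+ N) ^+ 2.
pose tau := 2 * s * (1 - delta).
pose q : R := d%:R - 1.
have s_gt0 : 0 < s by exact: lt_le_trans s_ge1.
have G_ge1 : 1 <= G by rewrite mulr_ege1 ?exprn_ege1 ?ler1n.
pose p := ('X + d%:R%:P) * (('X + (2 * s)%:P) * (('X + (2 * s)%:P) *
         (cheb q h ^+ N * cheb q h ^+ N))).
have pE x : p.[x] = let v := (cheb (s ^+ 2) h).[x] in
  (x + d%:R) * ((x + 2 * s) * ((x + 2 * s) * (v ^+ N * v ^+ N))).
  by rewrite sqr_s /p !(hornerM, hornerD, hornerX, hornerC, horner_exp).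
have trp : C * (n%:R / (4 * J%:R ^+ 3)) <= \sum_(x <- spectrum A) p.[x].
  have s2_ge0 : 0 <= 2 * s by rewrite mulr_ge0 // ltW.
  have := spectrum_test_ge e_sym e_reg d_gt1 n_gt0 N_gt0 J_gt0 (ler0n R d) s2_ge0 hJ.
  by apply: le_trans; rewrite le_eqVlt; apply/orP; left; apply/eqP; rewrite /C /G /s; ring.
have C_gt0 : 0 < C.
  have d_gt0 : 0 < d%:R :> R by rewrite ltr0n ltnW.
  have G_gt0 : 0 < G by exact: lt_le_trans G_ge1.
  by do ![apply: mulr_gt0 => // | apply: exprn_gt0 => //].
have pd_ge0 : 0 <= p.[d%:R].
  have ds0 : 0 <= d%:R + 2 * s by rewrite addr_ge0 ?ler0n ?mulr_ge0 ?(ltW s_gt0).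
  have y0 : 0 <= (cheb (s ^+ 2) h).[d%:R] ^+ N * (cheb (s ^+ 2) h).[d%:R] ^+ N.
    by rewrite -expr2 sqr_ge0.
  rewrite pE /= mulr_ge0 ?addr_ge0 ?ler0n //.
  by do ![done | apply: mulr_ge0].
have d_le : p.[d%:R] <= C * (8 * d%:R ^+ (2 * h * N + 2)).
  have /andP[v_ge v_le] : 0 <= (cheb q h).[d%:R] <= d%:R ^+ h.
    have q_ge0 : 0 <= q by rewrite subr_ge0 ler1n ltnW.
    have /andP[v1 v2] := cheb_degree h q_ge0; rewrite subrK in v1 v2.
    by rewrite v2 (le_trans _ v1) // exprn_ge0.
  rewrite pE sqr_s -/q /=.
  have yd : (cheb q h).[d%:R] ^+ N * (cheb q h).[d%:R] ^+ N <= d%:R ^+ (2 * h * N).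
    have -> : d%:R ^+ (2 * h * N) = (d%:R ^+ h) ^+ N * (d%:R ^+ h) ^+ N :> R.
      by rewrite -mulnA mul2n -addnn exprD exprM.
    have vN : (cheb q h).[d%:R] ^+ N <= (d%:R ^+ h) ^+ N.
      by apply: lerXn2r; rewrite ?nnegrE ?exprn_ge0 ?ler0n.
    by rewrite ler_pM ?exprn_ge0.
  (* This absorbs one of the three factors [2 * d] that bound the linear factors at [d]. *)
  have dC : d%:R <= C.
    rewrite /C -mulrA ler_peMr ?ler0n // mulr_ege1 ?exprn_ege1 //.
    by have := s_ge1; lra.
  have d0 : 0 <= d%:R :> R by exact: ler0n.
  have y0 : 0 <= (cheb q h).[d%:R] ^+ N * (cheb q h).[d%:R] ^+ N.
    by rewrite -expr2 sqr_ge0.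
  have ds : d%:R + 2 * s <= 2 * d%:R by have := rho_le; lra.
  have ds0 : 0 <= d%:R + 2 * s by lra.
  apply: (@le_trans _ _ ((2 * d%:R) * ((2 * d%:R) * ((2 * d%:R) * d%:R ^+ (2 * h * N))))).
    apply: ler_pM; [lra|by do ![done | apply: mulr_ge0]|lra|].
    apply: ler_pM; [lra|by do ![done | apply: mulr_ge0]|lra|].
    by apply: ler_pM.
  rewrite exprD; set D := d%:R ^+ _.
  have -> : 2 * d%:R * (2 * d%:R * (2 * d%:R * D)) = d%:R * (8 * (D * d%:R ^+ 2)) by ring.
  by rewrite ler_wpM2r // mulr_ge0 // mulr_ge0 ?exprn_ge0.
have point x : x \in spectrum A -> p.[x] <=
    C * (8 * (tau <= x)%R%:R + (2 * delta ^+ 2 + 8 * eps)) + (x == d%:R)%R%:R * p.[d%:R].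
  have c_ge0 (t : R) : 0 <= C * (8 * (tau <= t)%R%:R + (2 * delta ^+ 2 + 8 * eps)).
    apply: mulr_ge0; first exact: ltW.
    by rewrite !addr_ge0 // mulr_ge0 // sqr_ge0.
  case/spectrum_ramanujan => [->|->|x_le].
  - by rewrite eqxx mul1r lerDr.
  - rewrite pE /= addNr mul0r addr_ge0 //.
    by rewrite mulr_ge0.
  have := test_poly_le s_gt0 rho_le x_le delta_gt0 delta_le1 eps_ge0 epsP erefl.
  rewrite pE => /le_trans; apply.
  by rewrite lerDl mulr_ge0.
have Asym : A^T = A by apply/matrixP => i j; rewrite !mxE e_sym.
have sum_le : \sum_(x <- spectrum A) p.[x] <=
   C * (8 * (count (fun x => tau <= x) (spectrum A))%:R + n%:R * (2 * delta ^+ 2 + 8 * eps))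
   + p.[d%:R].
  apply: le_trans (_ : \sum_(x <- spectrum A) (C * (8 * (tau <= x)%R%:R +
    (2 * delta ^+ 2 + 8 * eps)) + (x == d%:R)%R%:R * p.[d%:R]) <= _).
    by rewrite big_seq [leRHS]big_seq; apply: ler_sum.
  rewrite big_split /= -mulr_sumr big_split /= -mulr_sumr natr_count.
  rewrite big_const_seq count_predT size_spectrum // iter_addr_0 -[_ *+ n]mulr_natl.
  rewrite -mulr_suml (natr_count R (pred1 d%:R)) lerD2l.
  rewrite ler_piMl // lern1.
  exact: count_top_eigenvalue.
rewrite -(ler_pM2l C_gt0); apply: le_trans trp (le_trans sum_le _).
by rewrite [leRHS]mulrDr lerD2l.
Qed.

End Counting.

(** * From graphs to matrices, and the window below [lambda2] *)

Section Graph.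
Variable G : sgraph.
Let e : rel 'I_#|G| := fun i j => adj (enum_val i) (enum_val j).

Lemma adj_ord_sym : symmetric e.
Proof. by move=> i j; apply: adj_sym. Qed.

Lemma adj_ord_reg d : regular d G -> forall i, (\sum_j e i j = d)%N.
Proof.
move=> Greg i; rewrite -(Greg (enum_val i)) -sum1dep_card.
rewrite [RHS]big_mkcond [RHS](reindex (@enum_val G predT)) /=; last first.
  by apply: onW_bij; apply: enum_val_bij.
by apply: eq_bigr => j _.
Qed.

Lemma adj_ord_conn : connected_graph G -> forall i j, connect e i j.
Proof.
move=> [_ Gconn] i j; rewrite -(enum_valK i) -(enum_valK j).
have /connectP[p pp ->] := Gconn (enum_val i) (enum_val j).
apply/connectP; exists (map enum_rank p); last by rewrite last_map.
rewrite path_map; apply: sub_path pp => x y xy.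
by rewrite /relpre /= /e !enum_rankK.
Qed.
End Graph.

(** Since [lambda2] is at most the Ramanujan bound, the window starts no later than the threshold on
    the left. The successor pays for the first entry of the spectrum, which may exceed [lambda2]. *)
Lemma count_le_eig_count (R : realType) (d : nat) (G : sgraph) (delta : R) :
  (1 < d)%N -> bipartite_ramanujan R d G -> 0 <= delta -> delta <= 1 ->
  (count (fun x : R => (2 * Num.sqrt (d%:R - 1) * (1 - delta) <= x)%R) (spectrum (adjmx R G))
    <= (eig_count G `[(lambda2 R G * (1 - delta))%R, lambda2 R G]).+1)%N.
Proof.
move=> d_gt1 [Gconn _ Greg Gram] delta_ge0 delta_le1.
rewrite /eig_count /lambda2.
have d_top : (count_mem d%:R (spectrum (adjmx R G)) <= 1)%N.
  exact: count_top_eigenvalue (@adj_ord_sym G) (adj_ord_reg Greg) (adj_ord_conn Gconn).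
have ram x : x \in spectrum (adjmx R G) ->
    [\/ x = d%:R, x = - d%:R | `|x| <= 2 * Num.sqrt (d%:R - 1)].
  exact: (spectrum_ramanujan (e := fun i j => adj (enum_val i) (enum_val j)) Gram).
have rho_le : 2 * Num.sqrt (d%:R - 1) <= d%:R :> R.
  exact: two_sqrt_pred_le.
have : sorted >=%R (spectrum (adjmx R G)) by apply: sort_sorted; exact: ge_total.
(* With fewer than two entries [lambda2] is the default 0, but the count is then at most 1. *)
case: (spectrum (adjmx R G)) d_top ram => [//|x0 [|x1 sp]] d_top ram.
  by move=> _; apply: leq_trans (count_size _ _) _.
move=> /= /andP[x10 sorted_sp].
have x_le x : x \in [:: x0, x1 & sp] -> x <= d%:R.
  case/ram => [->//|->|]; first by rewrite ge0_cp ?ler0n.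
  by rewrite ler_norml => /andP[_ x_le]; apply: le_trans rho_le.
have x1_le : x1 <= 2 * Num.sqrt (d%:R - 1).
  have [|x1d|x1d|] := ram x1; first by rewrite !inE eqxx orbT.
  (* If the second entry were [d], so would be the first, against simplicity. *)
  - have x0d : x0 = d%:R.
      by apply/le_anti; rewrite x_le ?inE ?eqxx //= -x1d.
    by move: d_top; rewrite /= x0d x1d !eqxx.
  - by rewrite x1d; apply: (@le_trans _ _ 0); rewrite ?oppr_le0 ?ler0n ?mulr_ge0 ?sqrtr_ge0.
  - by rewrite ler_norml => /andP[].
have sp_le : all (<= x1) (x1 :: sp).
  by rewrite /= lexx; apply: order_path_min sorted_sp; exact: ge_trans.
set P := (fun x : R => _ <= x); set I := mem _.
have PI x : x \in x1 :: sp -> P x = P x && I x.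
  move=> /(allP sp_le) /= x_le1; have [Px|//] := boolP (P x).
  suff: x \in `[x1 * (1 - delta), x1] by [].
  rewrite in_itv /= x_le1 andbT.
  by apply: le_trans Px; rewrite ler_wpM2r // subr_ge0.
apply: (@leq_trans (1 + count P (x1 :: sp))).
  by rewrite -[leqLHS]/(P x0 + count P (x1 :: sp))%N leq_add2r leq_b1.
rewrite add1n ltnS; apply: (@leq_trans (count I (x1 :: sp))); last exact: leq_addl.
by rewrite (eq_in_count PI); apply: sub_count => x /andP[].
Qed.

(** * Choice of parameters and asymptotic estimates *)

Lemma powR_expR_3half (R : realType) (t : R) : expR (8 * t) `^ (3 / 2) = expR t ^+ 12.
Proof. by rewrite -expRM -expRM_natl; congr expR; field. Qed.

Section Estimates.
Variable R : realFieldType.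
Implicit Types a c k l m t w x : R.

(** For [w] the inverse root of [delta], the product [w * l] has the order of [h * N]; the bound
    [t ^+ 5] stays far below the logarithm [t ^+ 8] of [n]. *)
Lemma edge_width_le t l w : 2 <= t -> 0 <= l -> l <= 8 * t -> 0 <= w ->
  l * w ^+ 2 = t ^+ 8 -> w * l <= 3 * t ^+ 5.
Proof.
move=> t_ge2 l_ge0 l_le w_ge0 lw2; have t_ge0 : 0 <= t by lra.
rewrite -(@ler_pXn2r _ 2) ?nnegrE ?mulr_ge0 ?exprn_ge0 //.
have -> : (w * l) ^+ 2 = l * (l * w ^+ 2) by ring.
have -> : (3 * t ^+ 5) ^+ 2 = 9 * t ^+ 2 * t ^+ 8 by ring.
rewrite lw2 ler_wpM2r ?exprn_ge0 //; apply: le_trans l_le _.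
by rewrite expr2 mulrA ler_wpM2r //; lra.
Qed.

(** The left side is at most [136 * t ^+ 2], and 544 is four times 136. *)
Lemma window_tail_le k t l : 0 < k -> 2 <= t -> 544 / k <= t -> 0 <= l -> l <= 8 * t ->
  2 * l ^+ 2 + 8 <= k / 4 * t ^+ 4.
Proof.
move=> k_gt0 t_ge2 kt l_ge0 l_le; have t_ge0 : 0 <= t by lra.
have l2 : l ^+ 2 <= 64 * t ^+ 2.
  have -> : 64 * t ^+ 2 = (8 * t) ^+ 2 by ring.
  by apply: lerXn2r; rewrite ?nnegrE ?mulr_ge0.
have t2 : 4 <= t ^+ 2.
  have -> : 4 = 2 ^+ 2 :> R by ring.
  by apply: lerXn2r; rewrite ?nnegrE.
apply: (@le_trans _ _ (136 * t ^+ 2)); first by lra.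
have -> : k / 4 * t ^+ 4 = (k * t / 4 * t) * t ^+ 2 by ring.
rewrite ler_wpM2r ?exprn_ge0 // -[leLHS]mulr1; apply: ler_pM => //; last by lra.
by move: kt; rewrite ler_pdivrMr // mulrC; lra.
Qed.

(** Compares logarithms: those of the power of [d], of a constant and of [t ^+ 12] against that of
    [n]. The exponent [2 * m + 2] is at most [26 * a * t ^+ 5]. *)
Lemma exponent_le a c D m t l : 1 <= a -> 0 <= c -> 0 <= D -> 2 <= t ->
  26 * a * D + c + 16 <= t -> m <= 12 * a * t ^+ 5 -> l <= 8 * t ->
  (2 * m + 2) * D + c + 12 * (l / 8) <= t ^+ 8.
Proof.
move=> a_ge1 c_ge0 D_ge0 t_ge2 t_ge m_le l_le.
have t_ge1 : 1 <= t by lra.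
have t5 : t <= t ^+ 5 by rewrite ler_eXnr.
have t5_ge0 : 0 <= t ^+ 5 by lra.
have at5 : 1 <= a * t ^+ 5 by rewrite mulr_ege1 //; lra.
have mD : (2 * m + 2) * D <= 26 * a * D * t ^+ 5.
  have -> : 26 * a * D * t ^+ 5 = 26 * (a * t ^+ 5) * D by ring.
  by rewrite ler_wpM2r //; lra.
apply: (@le_trans _ _ ((26 * a * D + c + 16) * t ^+ 5)).
  by have : c <= c * t ^+ 5 by [rewrite ler_peMr //; lra]; lra.
apply: (@le_trans _ _ (t * t ^+ 5)); first by rewrite ler_wpM2r.
by rewrite -exprS; apply: ler_weXn2l.
Qed.
End Estimates.

(** Rounds a real to a positive integer, losing at most a factor 2; it defines [h + 1], [N] and [J]
    below. *)
Lemma succn_trunc_itv (R : realType) (x : R) : 1 <= x ->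
  x <= (Num.truncn x).+1%:R <= 2 * x.
Proof.
move=> x1; rewrite (ltW (truncnS_gt _)) /= -natr1.
have : (Num.truncn x)%:R <= x by rewrite truncn_le; lra.
by lra.
Qed.

(** With [a] the base of the natural logarithm, [h + 1] is about [a] over the root of [delta], [N]
    about [ln L], and [J] about [4 * a] times the root of [L]. Then [delta * (h + 1)^2] is at least
    [a ^+ 2], and its [N]-th power at least [L ^+ 2]. *)
Lemma parameter_choice (R : realType) (d : nat) : (1 < d)%N ->
  exists2 c : R, 0 < c & exists N0 : nat, forall n, (N0 <= n)%N ->
  let L : R := ln n%:R in let delta := ln L / L in
  exists h N J : nat, [/\ (0 < N)%N, (0 < J)%N, 0 < delta <= 1,
    (delta ^+ N)^-1 <= L ^- 2 * (h.+1%:R ^+ N) ^+ 2 /\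
    2 * (N%:R * h.+1%:R ^+ 2) <= J%:R ^+ 2 :> R &
    8 * (c * (n%:R / L `^ (3 / 2))) +
      (n%:R * (2 * delta ^+ 2 + 8 * L ^- 2) + 8 * d%:R ^+ (2 * h * N + 2) + 8)
    <= n%:R / (4 * J%:R ^+ 3)].
Proof.
move=> d_gt1.
have [a aE] : exists a : R, a = expR 1 by eexists.
have a_ge2 : 2 <= a by have := expR_ge1Dx (1 : R); rewrite aE; lra.
have a_gt0 : 0 < a by lra.
have a_ge0 := ltW a_gt0.
have a_ge1 : 1 <= a by lra.
(* Rounding gives [J <= 8 * a * t ^+ 4], and 2048 is 4 times the cube of 8. *)
have [k kE] : exists k : R, k = (2048 * a ^+ 3)^-1 by eexists.
have k_gt0 : 0 < k by rewrite kE invr_gt0 mulr_gt0 ?exprn_gt0.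
have [C CE] : exists C, C = 64 / k by eexists.
have C_gt0 : 0 < C by rewrite CE divr_gt0.
have [D DE] : exists D : R, D = ln d%:R by eexists.
have D_ge0 : 0 <= D by rewrite DE; apply: ln_ge0; rewrite ler1n ltnW.
have [T [T_ge1 T_ge2 T_ge3]] : exists T : R,
    [/\ a <= T, 544 / k <= T & 26 * a * D + C + 16 <= T].
  exists (a + 544 / k + (26 * a * D + C + 16)).
  have : 0 <= 544 / k by rewrite divr_ge0 // ltW.
  have : 0 <= 26 * a * D by rewrite !mulr_ge0.
  by split; lra.
have T_gt1 : 1 < T by lra.
(* The main term then takes half of the budget [k]; the tail takes a quarter, and the power of [d]
   with the summand 8 takes the last quarter. *)
exists (k / 16); first by rewrite divr_gt0.
exists (Num.truncn (expR (T ^+ 8))).+1 => n n_ge.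
have n_gt : expR (T ^+ 8) < n%:R.
  by apply: lt_le_trans (truncnS_gt _) _; rewrite ler_nat.
have n_gt0 : 0 < n%:R :> R by apply: lt_trans n_gt; exact: expR_gt0.
have [L LnE] : exists L : R, L = ln n%:R by eexists.
rewrite -LnE /=.
have L_gt : T ^+ 8 < L by rewrite -[T ^+ 8]expRK LnE ltr_ln ?posrE ?expR_gt0.
have L_gt1 : 1 < L by apply: lt_trans L_gt; rewrite exprn_egt1.
have L_gt0 : 0 < L by exact: lt_trans L_gt1.
have nE : n%:R = expR L :> R by rewrite LnE lnK.
have [l lE] : exists l, l = ln L by eexists.
have LE : L = expR l by rewrite lE lnK.
rewrite -lE.
(* The eighth root of [L] turns every scale into an integer power: [L] to the 3/2 is [t ^+ 12]. *)
have [t tE] : exists t, t = expR (l / 8) by eexists.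
have Lt : L = t ^+ 8 by rewrite tE -expRM_natl LE; congr expR; field.
have t_gt0 : 0 < t by rewrite tE expR_gt0.
have t_ge0 := ltW t_gt0.
have tT : T <= t.
  rewrite leNgt; apply/negP => tT; move: L_gt; rewrite ltNge Lt => /negP; apply.
  by apply: lerXn2r (ltW tT); rewrite nnegrE // ltW // (lt_trans _ T_gt1).
have t_ge2 : 2 <= t by exact: le_trans (le_trans a_ge2 T_ge1) tT.
have t_ge1 : 1 <= t by apply: le_trans t_ge2; rewrite ler1n.
have l_le : l <= 8 * t by have := expR_ge1Dx (l / 8); rewrite -tE; clear; lra.
have l_ge1 : 1 <= l.
  rewrite lE -[1]expRK -aE ler_ln ?posrE // Lt.
  by apply: le_trans (le_trans T_ge1 tT) _; rewrite ler_eXnr.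
have l_gt0 : 0 < l by exact: lt_le_trans l_ge1.
have l_ge0 := ltW l_gt0.
have L3 : L `^ (3 / 2) = t ^+ 12.
  by rewrite LE tE -powR_expR_3half; congr (expR _ `^ _); field.
have [delta deltaE] : exists delta, delta = l / L by eexists.
rewrite -deltaE.
have delta_gt0 : 0 < delta by rewrite deltaE divr_gt0.
have delta_ge0 := ltW delta_gt0.
have delta_le1 : delta <= 1.
  by rewrite deltaE ler_pdivrMr // mul1r lE ltW // ln_sublinear.
have [w wE] : exists w, w = Num.sqrt delta^-1 by eexists.
have w_ge1 : 1 <= w by rewrite wE -sqrtr1 ler_sqrt ?invr_ge0 // invf_ge1.
have w_ge0 : 0 <= w by exact: le_trans w_ge1.
have w2 : delta * w ^+ 2 = 1.
  by rewrite wE sqr_sqrtr ?invr_ge0 // divff // lt0r_neq0.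
have lw2 : l * w ^+ 2 = L.
  by apply: (mulfI (lt0r_neq0 delta_gt0)); rewrite mulrCA w2 deltaE divfK ?mulr1 ?lt0r_neq0.
have wl : w * l <= 3 * t ^+ 5 by apply: edge_width_le; rewrite // -Lt.
have aw_ge1 : 1 <= a * w by rewrite mulr_ege1.
have /andP[h_ge h_le] := succn_trunc_itv aw_ge1.
have /andP[N_ge N_le] := succn_trunc_itv l_ge1.
have at_ge1 : 1 <= 4 * a * t ^+ 4 by rewrite !mulr_ege1 ?exprn_ege1 ?ler1n.
have /andP[J_ge J_le] := succn_trunc_itv at_ge1.
move: (Num.truncn (a * w)) (Num.truncn l) (Num.truncn (4 * a * t ^+ 4))
  h_ge h_le N_ge N_le J_ge J_le => h N J h_ge h_le N_ge N_le J_ge J_le.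
exists h, N.+1, J.+1; split=> //; first by rewrite delta_gt0.
  split.
    have H2 : a ^+ 2 <= delta * h.+1%:R ^+ 2.
      have -> : a ^+ 2 = delta * (a * w) ^+ 2 by rewrite exprMn mulrCA w2 mulr1.
      by rewrite ler_wpM2l //; apply: lerXn2r; rewrite ?nnegrE ?ler0n ?mulr_ge0.
    have LN : L ^+ 2 <= (a ^+ 2) ^+ N.+1.
      rewrite LE -exprM mulnC exprM; apply: lerXn2r; rewrite ?nnegrE ?exprn_ge0 ?expR_ge0 //.
      by rewrite aE -expRM_natl mulr1 ler_expR.
    have L2_gt0 : 0 < L ^+ 2 by exact: exprn_gt0.
    rewrite [leRHS]mulrC ler_pdivlMr // ler_pdivrMl ?exprn_gt0 //.
    apply: le_trans LN _; rewrite -[(h.+1%:R ^+ _) ^+ 2]exprM mulnC exprM -exprMn.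
    by apply: lerXn2r; rewrite ?nnegrE ?mulr_ge0 ?exprn_ge0.
  have h2 : h.+1%:R ^+ 2 <= (2 * (a * w)) ^+ 2 :> R.
    by apply: lerXn2r; rewrite ?nnegrE ?ler0n ?mulr_ge0.
  apply: (@le_trans _ _ ((4 * a * t ^+ 4) ^+ 2)); last first.
    by apply: lerXn2r; rewrite ?nnegrE ?ler0n ?mulr_ge0 ?exprn_ge0.
  have -> : (4 * a * t ^+ 4) ^+ 2 = 2 * (2 * l * (2 * (a * w)) ^+ 2).
    transitivity (16 * a ^+ 2 * t ^+ 8); first by ring.
    by rewrite -Lt -lw2; ring.
  by rewrite ler_wpM2l // ler_pM ?exprn_ge0.
rewrite L3.
have t12 : 0 < t ^+ 12 by exact: exprn_gt0.
have n_ge0 := ltW n_gt0.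
have stepA : k * (n%:R / t ^+ 12) <= n%:R / (4 * J.+1%:R ^+ 3).
  rewrite mulrCA ler_wpM2l // kE -invfM lef_pV2 ?posrE ?mulr_gt0 ?exprn_gt0 //.
  have -> : 2048 * a ^+ 3 * t ^+ 12 = 4 * (2 * (4 * a * t ^+ 4)) ^+ 3 by ring.
  by rewrite ler_wpM2l //; apply: lerXn2r; rewrite ?nnegrE ?ler0n ?mulr_ge0 ?exprn_ge0.
have stepB : n%:R * (2 * delta ^+ 2 + 8 * L ^- 2) <= k * (n%:R / t ^+ 12) / 4.
  have -> : k * (n%:R / t ^+ 12) / 4 = n%:R * (k / 4 / t ^+ 12) by ring.
  rewrite ler_wpM2l // ler_pdivlMr //.
  have -> : (2 * delta ^+ 2 + 8 * L ^- 2) * t ^+ 12 = (2 * l ^+ 2 + 8) / t ^+ 4.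
    by rewrite deltaE Lt; field; rewrite lt0r_neq0.
  rewrite ler_pdivrMr ?exprn_gt0 //; apply: window_tail_le => //.
  exact: le_trans T_ge2 tT.
have d_gt0 : 0 < d%:R :> R by rewrite ltr0n ltnW.
have [P PE] : exists P : R, P = d%:R ^+ (2 * h * N.+1 + 2) by eexists.
have P_ge1 : 1 <= P by rewrite PE exprn_ege1 // ler1n ltnW.
rewrite -PE.
have stepC : 16 * P <= k * (n%:R / t ^+ 12) / 4.
  have -> : k * (n%:R / t ^+ 12) / 4 = k / 4 * n%:R / t ^+ 12 by ring.
  rewrite ler_pdivlMr // -ler_pdivrMl ?divr_gt0 //.
  have -> : (k / 4)^-1 * (16 * P * t ^+ 12) = C * t ^+ 12 * P.
    by rewrite CE; field; rewrite lt0r_neq0.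
  have PexpE : P = expR ((2 * (h%:R * N.+1%:R) + 2) * D).
    rewrite PE -[d%:R in LHS]lnK ?posrE // -expRM_natl -DE; congr expR.
    by rewrite natrD !natrM; ring.
  (* Replacing [C] by [expR C] reduces the claim to an inequality between exponents. *)
  apply: (@le_trans _ _ (expR C * t ^+ 12 * P)).
    have P_ge0 : 0 <= P by exact: le_trans P_ge1.
    rewrite ler_wpM2r // ler_wpM2r ?(ltW t12) //.
    by apply: le_trans (expR_ge1Dx C); rewrite lerDr.
  rewrite PexpE nE tE -expRM_natl -!expRD ler_expR Lt addrC addrA.
  apply: (exponent_le a_ge1 (ltW C_gt0) D_ge0 t_ge2 (le_trans T_ge3 tT) _ l_le).
  have -> : 12 * a * t ^+ 5 = 4 * a * (3 * t ^+ 5) by ring.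
  apply: (@le_trans _ _ ((2 * (a * w)) * (2 * l))).
    by apply: ler_pM => //; apply: le_trans h_le; rewrite ler_nat.
  have -> : 2 * (a * w) * (2 * l) = 4 * a * (w * l) by ring.
  by rewrite ler_wpM2l // mulr_ge0.
have -> : k / 16 * (n%:R / t ^+ 12) = k * (n%:R / t ^+ 12) / 16 by ring.
move: (k * _) (_ / (4 * _)) (_ * (2 * _ + _)) stepA stepB stepC P_ge1 => x y z.
clear; lra.
Qed.

Theorem proposition5p2 (R : realType) :
  exists2 alpha : R, 0 < alpha &
    forall d : nat, (3 <= d)%N ->
    exists2 c : R, 0 < c &
    exists N : nat,
    forall (n : nat) (G : sgraph), (N <= n)%N -> #|G| = n ->
      bipartite_ramanujan R d G ->
      c * (n%:R / (ln n%:R) `^ (3 / 2))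
        <= (eig_count G
             `[lambda2 R G * (1 - alpha * (ln (ln n%:R) / ln n%:R)),
               lambda2 R G])%:R.
Proof.
(* With [alpha = 1] the relative width of the window is exactly [delta]. *)
exists 1 => // d d_ge3; have d_gt1 : (1 < d)%N by exact: ltnW.
have [c c_gt0 [N0 paramP]] := parameter_choice R d_gt1.
exists c => //; exists N0 => n G n_ge Gn Gram.
have [h [N [J [N_gt0 J_gt0 /andP[delta_gt0 delta_le1] [epsP hJ] bound]]]] := paramP n n_ge.
rewrite mul1r; move: (ln (ln n%:R) / ln n%:R) delta_gt0 delta_le1 epsP bound.
move=> delta delta_gt0 delta_le1 epsP bound.
have [G_conn _ G_reg G_eig] := Gram; have [G_gt0 _] := G_conn; rewrite -Gn in bound *.
have eps_ge0 : 0 <= (ln n%:R : R) ^- 2 by rewrite invr_ge0 sqr_ge0.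
have := count_near_edge (@adj_ord_sym G) (adj_ord_reg G_reg) (adj_ord_conn G_conn)
  d_gt1 G_eig G_gt0 N_gt0 J_gt0 delta_gt0 delta_le1 eps_ge0 epsP hJ.
have := count_le_eig_count d_gt1 Gram (ltW delta_gt0) delta_le1.
(* The extra eigenvalue allowed by [count_le_eig_count] enters with weight 8, which is the constant
   8 reserved in [bound]. *)
rewrite -(ler_nat R) -natr1 -/(adjmx R G) -Gn in bound *.
lra.
Qed.
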